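(* Let $X$ be a Hausdorff topological vector space over $\mathbb{R}$ or $\mathbb{C}$, $\Omega\subset X$ open, $A\subset\Omega$ a nonempty convex set, $H$ a nonempty set of positively homogeneous of degree one functions $X\to\overline{\mathbb{R}}$, and $f_0\colon\Omega\to\mathbb{R}$. Let $f_0$ be Dini (respectively, Hadamard) $H$-quasidifferentiable at a point $x^*\in A$, and suppose that $x^*$ is a point of local minimum of $f_0$ on $A$. Let $K=\gamma(x^*,A)$ in the Dini case (respectively, $K=\Gamma(x^*,A)$ in the Hadamard case). Then for any $(\Phi,\Psi)\in\mathcal{D}_Hf_0(x^* )$: (a) for every $p\in\operatorname{supp}^+(\Psi,H)$ the function $\Phi+p$ attains a global minimum value on $K$ at the origin; (b) for any $U\subset H$ such that $\Phi=\sup_{h\in U}h$, for any $\varepsilon>0$ and any $g\in K$ there exists $h\in U$ such that $h(g)+\Psi(g)\ge-\varepsilon$; (c) if there exists $U\subset H$ such that $\Phi=\sup_{h\in U}h$ and for any $x\in X$ there exists $h\in U$ with $\Phi(x)=h(x)$ (in particular, if $U$ is finite), then for any $g\in K$ there exists $h\in U$ such that $h(g)+\Psi(g)\ge0$.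
   Context: $\overline{\mathbb{R}}=\mathbb{R}\cup\{\pm\infty\}$; for $f\colon X\to\overline{\mathbb{R}}$, $\operatorname{dom}f=\{x: f(x)\in\mathbb{R}\}$. $h$ is positively homogeneous of degree one if $h(0)=0$ and $h(\lambda x)=\lambda h(x)$ for all $\lambda>0$, $x\in X$. A function $X\to\overline{\mathbb{R}}$ is $H$-convex (resp. $H$-concave) if it is the pointwise supremum (resp. infimum) of a nonempty subset of $H$. $\operatorname{supp}^+(\Psi,H)=\{p\in H\mid\Psi\le p\text{ on }X\}$. $\gamma(x,A)=\{g\in X\mid\exists\alpha>0:\ x+\alpha g\in A\}$, $\Gamma(x,A)=\operatorname{cl}\gamma(x,A)$. The Dini directional derivative of $f$ at $x$ in direction $g$ is $f'(x,g)=\lim_{\alpha\downarrow0}(f(x+\alpha g)-f(x))/\alpha$; the Hadamard directional derivative is $f'(x,g)=\lim_{\alpha\downarrow0,\,g'\to g}(f(x+\alpha g')-f(x))/\alpha$; $f$ is Dini (Hadamard) directionally differentiable at $x$ if the corresponding finite limit exists for every $g\in X$. $f\colon\Omega\to\mathbb{R}$ is Dini (Hadamard) $H$-quasidifferentiable at $x\in\Omega$ if it is Dini (Hadamard) directionally differentiable at $x$ and there is a pair $(\Phi,\Psi)$ with $\Phi\colon X\to\overline{\mathbb{R}}$ $H$-convex, $\Psi\colon X\to\overline{\mathbb{R}}$ $H$-concave, $\operatorname{dom}\Phi\cap\operatorname{dom}\Psi$ containing a neighbourhood of $0$, and $f'(x,g)=\Phi(g)+\Psi(g)$ for all $g\in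 X$. The $H$-quasidifferential $\mathcal{D}_Hf(x)$ is the set (equivalence class) of all such pairs. *)

(* Defs.v *)
From HB Require Import structures.
From mathcomp Require Import all_boot all_order all_algebra.
From mathcomp Require Import all_classical all_reals all_analysis.
From mathcomp Require Import complex.
Set Implicit Arguments.
Unset Strict Implicit.
Unset Printing Implicit Defensive.
Import Order.TTheory GRing.Theory Num.Theory.
Import numFieldNormedType.Exports.
Local Open Scope classical_set_scope.
Local Open Scope ring_scope.

Inductive scalar_kind := RealScalars | ComplexScalars.

(* For [k = ComplexScalars] the order of [R[i]] is the partial one (where
   [0 <= t <= 1] forces [t] real), so [convex_set] over [scalars R k] is
   convexity with respect to real coefficients in both cases. *)
Definition scalars (R : realType) (k : scalar_kind) : numFieldType :=
  match k with RealScalars => R | ComplexScalars => R[i] end.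

Definition real_scalar (R : realType) (k : scalar_kind) : R -> scalars R k :=
  match k with
  | RealScalars => fun a => a
  | ComplexScalars => fun a => a%:C%C
  end.

Inductive dirderiv_kind := Dini | Hadamard.

Section Quasidifferentials.
Context (R : realType) (k : scalar_kind) (X : topologicalLmodType (scalars R k)).
Implicit Types (f : X -> R) (x g : X) (A : set X).
Implicit Types (h Phi Psi : X -> \bar R) (H U : set (X -> \bar R)).

Definition dom h : set X := [set x | h x \is a fin_num].

Definition pos_homogeneous h : Prop :=
  h 0 = 0%E /\
  forall (a : R) x, 0 < a -> h (real_scalar k a *: x) = (a%:E * h x)%E.

(* [ereal_sup set0 = -oo] and [ereal_inf set0 = +oo]: nonemptiness of [U] is
   required separately below. *)
Definition sup_envelope U : X -> \bar R :=
  fun x => ereal_sup [set h x | h in U].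
Definition inf_envelope U : X -> \bar R :=
  fun x => ereal_inf [set h x | h in U].

Definition Hconvex H Phi : Prop :=
  exists U, [/\ U !=set0, U `<=` H & Phi = sup_envelope U].
Definition Hconcave H Psi : Prop :=
  exists U, [/\ U !=set0, U `<=` H & Psi = inf_envelope U].

Definition upper_support Psi H : set (X -> \bar R) :=
  [set p | H p /\ forall x, (Psi x <= p x)%E].

Definition gamma x A : set X :=
  [set g | exists2 a : R, 0 < a & A (x + real_scalar k a *: g)].
Definition Gamma x A : set X := closure (gamma x A).

Definition cone_at (m : dirderiv_kind) x A : set X :=
  match m with Dini => gamma x A | Hadamard => Gamma x A end.

Definition diff_quotient f x (a : R) g : R :=
  (f (x + real_scalar k a *: g) - f x) / a.

(* A function defined on an open set [Omega] containing [x] is represented by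
   any extension to [X]: only its values near [x] matter in these limits. *)
Definition is_dirderiv (m : dirderiv_kind) f x g (l : R) : Prop :=
  match m with
  | Dini => diff_quotient f x a g @[a --> 0^'+] --> l
  | Hadamard =>
      diff_quotient f x z.1 z.2 @[z --> filter_prod 0^'+ (nbhs g)] --> l
  end.

Definition dir_differentiable m f x : Prop :=
  forall g, exists l : R, is_dirderiv m f x g l.

(* The sum [P.1 g + P.2 g] is never of the form [+oo + -oo] when [H] consists of
   positively homogeneous functions, both terms being finite near 0 and hence
   everywhere. *)
Definition quasidifferential m H f x :
    set ((X -> \bar R) * (X -> \bar R)) :=
  [set P | [/\ Hconvex H P.1, Hconcave H P.2,
               nbhs 0 (dom P.1 `&` dom P.2) &
               forall g, exists2 l : R,
                 is_dirderiv m f x g l & l%:E = (P.1 g + P.2 g)%E]].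

Definition quasidifferentiable m H f x : Prop :=
  dir_differentiable m f x /\ quasidifferential m H f x !=set0.

Definition local_min_on f A x : Prop :=
  A x /\ \forall y \near x, A y -> f x <= f y.

Definition global_min_on h A x : Prop :=
  A x /\ forall y, A y -> (h x <= h y)%E.

End Quasidifferentials.

(* Main.v *)
(** By convexity, a direction [g] of [gamma xs A] stays feasible for all small
    steps, so the difference quotients of [f0] along [g] are eventually
    nonnegative and so is their limit [Phi g + Psi g]. In the Hadamard case the
    limit at [g] is joint in the step and the direction, so a negative value at
    [g] in the closure would give negative quotients at arbitrarily small steps
    along some nearby direction of [gamma xs A]. Then (a) follows from
    [Psi <= p], and (b) and (c) from the definition of the supremum. *)
Require Import Defs.
From HB Require Import structures.
From mathcomp Require Import all_boot all_order all_algebra.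
From mathcomp Require Import all_classical all_reals all_analysis.
From mathcomp Require Import complex.
Import Order.TTheory GRing.Theory Num.Theory.
Import numFieldNormedType.Exports.
Local Open Scope classical_set_scope.
Local Open Scope ring_scope.

(** A nonempty list has a largest element, by induction starting from singletons, and an upper bound
    lying in the set is its supremum. This supplies the attainment needed in (c) for finite [U]. *)
Lemma ereal_sup_finite (R : realType) (S : set (\bar R)) :
  finite_set S -> S !=set0 -> S (ereal_sup S).
Proof.
case/finite_seqP=> s ->; rewrite /= => -[x xs].
suff [y ys ub] : exists2 y, y \in s & forall z, z \in s -> (z <= y)%E.
  suff -> : ereal_sup [set` s] = y by [].
  by apply/eqP; rewrite eq_le ge_ereal_sup// ereal_sup_ubound.
elim: s x xs => [//|a [|b s] IH] x _.
  by exists a => [|z]; rewrite !inE// => /eqP ->.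
have [y ys ub] := IH b (mem_head b s).
have [ay|ya] := leP a y.
  exists y => [|z]; rewrite in_cons ?ys ?orbT// => /orP[/eqP ->//|]; exact: ub.
exists a => [|z]; first exact: mem_head.
by rewrite in_cons => /orP[/eqP ->//|/ub zy]; exact: le_trans (ltW ya).
Qed.

Section RealScalar.
Context (R : realType) (k : scalar_kind).
Implicit Types a b : R.

Lemma real_scalar1 : real_scalar k (1 : R) = 1.
Proof. by case: k. Qed.

Lemma real_scalarM a b :
  real_scalar k (a * b) = real_scalar k a * real_scalar k b.
Proof. by case: k => //=; rewrite rmorphM. Qed.

Lemma le_real_scalar a b : (real_scalar k a <= real_scalar k b) = (a <= b).
Proof. by case: k => //=; rewrite lecR. Qed.

Lemma real_scalar0 : real_scalar k (0 : R) = 0.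
Proof. by case: k. Qed.

Lemma cvg_real_scalar0 :
  (real_scalar k a : scalars R k) @[a --> (0 : R)^'+] --> (0 : scalars R k).
Proof.
apply/cvgrPdist_lt; case: k => /= e e0.
  near=> t; rewrite sub0r normrN gtr0_norm//; near: t; exact: nbhs_right_lt.
(* A positive complex [e] has zero imaginary part, so the bound reduces to the real inequality
   [t < e1]. *)
case: e e0 => e1 e2; rewrite ltcE/= => /andP[/eqP e20 e10].
near=> t.
rewrite sub0r normrN ger0_norm ?lecR//.
by rewrite ltcE/= -e20 eqxx; near: t; exact: nbhs_right_lt.
Unshelve. all: by end_near. Qed.

End RealScalar.

Section LocalMinimum.
Context (R : realType) (k : scalar_kind) (X : topologicalLmodType (scalars R k)).
Implicit Types (f : X -> R) (x g : X) (A : set X).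

Lemma cvg_ray x g : x + real_scalar k a *: g @[a --> (0 : R)^'+] --> x.
Proof.
rewrite -[X in _ --> X]addr0 -[X in _ --> _ + X](scale0r g).
have sg : real_scalar k a *: g @[a --> (0 : R)^'+] --> (0 : scalars R k) *: g.
  have cvg0g : (real_scalar k a : (scalars R k)^o, g) @[a --> (0 : R)^'+] -->
      ((0 : (scalars R k)^o), g).
    exact: (cvg_pair (@cvg_real_scalar0 R k) (cvg_cst g)).
  exact: (cvg_comp _ _ cvg0g (@scale_continuous _ X (0, g))).
have cvgx0 : (x, real_scalar k a *: g) @[a --> (0 : R)^'+] -->
    (x, (0 : scalars R k) *: g).
  exact: (cvg_pair (cvg_cst x) sg).
exact: (cvg_comp _ _ cvgx0 (@add_continuous X (x, 0 *: g))).
Qed.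

(** If [x + b g] lies in [A] and [0 < a <= b], then [x + a g] is the convex combination of [x + b g]
    and [x] with weights [a / b] and [1 - a / b]. *)
Lemma gamma_near A x g : @convex_set (scalars R k) X A -> A x -> gamma x A g ->
  \forall a \near (0 : R)^'+, A (x + real_scalar k a *: g).
Proof.
move=> cA Ax [b b0 Ab]; near=> a.
have a0 : 0 < a by [].
have ab : a <= b by near: a; exact: nbhs_right_le.
have l0 : 0 <= real_scalar k (a / b).
  by rewrite -(real_scalar0 R k) le_real_scalar divr_ge0// ltW.
have l1 : real_scalar k (a / b) <= 1.
  by rewrite -(real_scalar1 R k) le_real_scalar ler_pdivrMr// mul1r.
have := cA _ _ (Itv01 l0 l1) (mem_set Ab) (mem_set Ax).
rewrite inE/=; congr A.
rewrite /conv/= scalerDr scalerA -real_scalarM divfK ?gt_eqF//.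
by rewrite addrAC -scalerDl subrKC scale1r.
Unshelve. all: by end_near. Qed.

Lemma gamma_diff_quotient_ge0 f A x g : @convex_set (scalars R k) X A ->
  local_min_on f A x -> gamma x A g ->
  \forall a \near (0 : R)^'+, 0 <= diff_quotient f x a g.
Proof.
move=> cA [Ax fmin] xAg; near=> a.
rewrite divr_ge0 ?subr_ge0//.
have: A (x + real_scalar k a *: g) by near: a; exact: gamma_near.
by near: a; exact: (cvg_ray x g _ fmin).
Unshelve. all: by end_near. Qed.

Arguments gamma_diff_quotient_ge0 {f A x g}.

Lemma dirderiv_ge0 m f A x g l : @convex_set (scalars R k) X A ->
  local_min_on f A x -> cone_at m x A g -> is_dirderiv m f x g l -> 0 <= l.
Proof.
move=> cA fmin; case: m => /= xAg fl; rewrite leNgt; apply/negP => l0.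
  have ge0 := gamma_diff_quotient_ge0 cA fmin xAg.
  have [a [age0]] := @filter_ex _ _ (at_right_proper_filter 0) _
    (filterI ge0 (cvgr_lt l fl 0 l0)).
  by rewrite ltNge age0.
(* The quotients are negative on a whole product [P * Q]. As [Q] is a neighbourhood of [g], it
   contains some [g'] of [gamma x A]; this [g'] is fixed before the step [a] is chosen in [P]. *)
have [[P Q] [/= P0 Qg] PQ] := cvgr_lt l fl 0 l0.
have [g' [xAg' Qg']] := xAg _ Qg.
have ge0 := gamma_diff_quotient_ge0 cA fmin xAg'.
have [a [age0 Pa]] := @filter_ex _ _ (at_right_proper_filter 0) _
  (filterI ge0 P0).
by have := PQ (a, g') (conj Pa Qg'); rewrite /= ltNge age0.
Qed.

Lemma cone_at_0 m A x : A x -> cone_at m x A 0.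
Proof.
move=> Ax; have g0 : gamma x A 0 by exists 1; rewrite // scaler0 addr0.
by case: m => //; exact: subset_closure.
Qed.

End LocalMinimum.
Arguments dirderiv_ge0 {R k X m f A x g l}.

(** Every member of [U] vanishes at the origin, so the supremum there is taken over [{0}]; an empty
    [U] would give [-oo] instead. *)
Lemma pos_homogeneous_sup_envelope0 (R : realType) (k : scalar_kind)
    (X : topologicalLmodType (scalars R k)) (U : set (X -> \bar R)) :
  U !=set0 -> (forall h, U h -> pos_homogeneous h) -> sup_envelope U 0 = 0%E.
Proof.
move=> [h Uh] homU; rewrite /sup_envelope.
suff -> : [set h 0 | h in U] = [set 0%E] by rewrite ereal_sup1.
apply/seteqP; split => [_ [h' Uh' <-]|_ ->] /=; first by have [] := homU _ Uh'.
by exists h => //; have [] := homU _ Uh.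
Qed.

Theorem theorem5p8 (R : realType) (k : scalar_kind)
    (X : topologicalLmodType (scalars R k)) (hX : hausdorff_space X)
    (Omega A : set X) (hOmega : open Omega) (hAOmega : A `<=` Omega)
    (hA0 : A !=set0) (hA : @convex_set (scalars R k) X A)
    (H : set (X -> \bar R)) (hH0 : H !=set0)
    (hH : forall h, H h -> pos_homogeneous h)
    (f0 : X -> R) (m : dirderiv_kind) (xs : X) (hxs : A xs)
    (hquasi : quasidifferentiable m H f0 xs)
    (hmin : local_min_on f0 A xs)
    (Phi Psi : X -> \bar R)
    (hD : quasidifferential m H f0 xs (Phi, Psi)) :
  let K := cone_at m xs A in
  [/\ (* (a) *)
      forall p, upper_support Psi H p ->
        global_min_on (fun g => Phi g + p g)%E K 0,
      (* (b) *)
      forall U, U `<=` H -> Phi = sup_envelope U ->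
        forall (eps : R) g, 0 < eps -> K g ->
          exists2 h, U h & ((- eps)%:E <= h g + Psi g)%E,
      (* (c) *)
      forall U, U `<=` H -> Phi = sup_envelope U ->
        (forall x, exists2 h, U h & Phi x = h x) ->
        forall g, K g -> exists2 h, U h & (0 <= h g + Psi g)%E &
      (* (c), the case of a finite U *)
      forall U, U `<=` H -> Phi = sup_envelope U -> finite_set U ->
        (forall x, exists2 h, U h & Phi x = h x) /\
        (forall g, K g -> exists2 h, U h & (0 <= h g + Psi g)%E)].
Proof.
move=> K.
have [[V [V0 VH /= PhiE]] _ _ derE] := hD.
have Phi0 : Phi 0 = 0%E.
  by rewrite PhiE pos_homogeneous_sup_envelope0// => h /VH/hH.
(* The sum is a real directional derivative; its finiteness forces that of both terms, which the
   approximation of the supremum in (b) relies on. *)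
have sum_fin g : (Phi g + Psi g)%E \is a fin_num by have [l _ /= <-] := derE g.
have sum_ge0 g : K g -> (0 <= Phi g + Psi g)%E.
  move=> Kg; have [l fl /= <-] := derE g.
  by rewrite lee_fin (dirderiv_ge0 hA hmin Kg fl).
have attained U : Phi = sup_envelope U ->
    (forall x, exists2 h, U h & Phi x = h x) ->
    forall g, K g -> exists2 h, U h & (0 <= h g + Psi g)%E.
  by move=> _ att g /sum_ge0; have [h Uh ->] := att g; exists h.
split.
- move=> p [/hH[p0 _] Psip]; split=> [|g Kg]; first exact: cone_at_0.
  (* The value at the origin is 0, and [0 <= Phi g + Psi g <= Phi g + p g]. *)
  by rewrite Phi0 p0 adde0 (le_trans (sum_ge0 g Kg))// leeD2l.
- move=> U UH PhiU eps g eps0 /sum_ge0 ge0.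
  have := sum_fin g; rewrite fin_numD => /andP[Phifin Psifin].
  have := Phifin; rewrite {1}PhiU => /(ub_ereal_sup_adherent eps0)[_ [h Uh <-]].
  rewrite -[ereal_sup _]/(sup_envelope U g) -PhiU => /ltW lt_h; exists h => //.
  (* Adding [Psi g] to [Phi g - eps <= h g] leaves [- eps <= Phi g - eps + Psi g], which is
     [sum_ge0] shifted by [- eps]. *)
  apply: le_trans (leeD2r (Psi g) lt_h).
  by rewrite addeAC EFinN -[leLHS]add0e leeD2r.
- by move=> U _; exact: attained.
- move=> U UH PhiU finU.
  have U0 : U !=set0.
    (* An empty [U] would make [Phi 0] equal to [-oo] rather than 0. *)
    apply/set0P/eqP => U0; have := Phi0.
    by rewrite PhiU /sup_envelope U0 image_set0 ereal_sup0.
  have att x : exists2 h, U h & Phi x = h x.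
    have : [set h x | h in U] (Phi x).
      rewrite PhiU.
      by apply: ereal_sup_finite; [exact: finite_image|exact: image_nonempty].
    by case=> h Uh hx; exists h.
  by split=> //; exact: attained.
Qed.
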